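(* Let $m,n\ge 2$ be integers and let $F_{m,n}=\overline{K}_m+P_n$ be the generalized fan graph. Then the eigenvalues of the Laplacian matrix $L(F_{m,n})$, listed as a multiset of $m+n$ values, are: $0$ with multiplicity $1$; $m+n$ with multiplicity $1$; $n$ with multiplicity $m-1$; and $m+2-2\cos\frac{\pi j}{n}$ with multiplicity $1$ for each $1\le j\le n-1$.
   Context: Graphs are finite, simple and undirected. The Laplacian matrix of a graph $G$ is $L(G)=\mathrm{Deg}(G)-A(G)$, where $A(G)$ is the adjacency matrix and $\mathrm{Deg}(G)$ is the diagonal matrix of vertex degrees. $G_1+G_2$ denotes the join of $G_1$ and $G_2$ (the disjoint union together with all edges between vertices of $G_1$ and vertices of $G_2$). $\overline{K}_m$ is the graph on $m$ vertices with no edges and $P_n$ is the path on $n$ vertices. Convention: the spectrum is described as a multiset of eigenvalues counted with multiplicity; if some listed values coincide, their multiplicities add. *)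

(* Defs.v *)
From mathcomp Require Import all_boot all_order all_algebra.

Set Implicit Arguments.
Unset Strict Implicit.
Unset Printing Implicit Defensive.

Import Order.TTheory GRing.Theory Num.Theory.
Local Open Scope ring_scope.

Record sgraph := SGraph {
  vertex :> finType;
  adj : rel vertex;
  adj_sym : symmetric adj;
  adj_irrefl : irreflexive adj }.

Section EdgelessPath.
Variable n : nat.

Definition edgeless_rel : rel 'I_n := fun _ _ => false.

Lemma edgeless_sym : symmetric edgeless_rel. Proof. by []. Qed.
Lemma edgeless_irrefl : irreflexive edgeless_rel. Proof. by []. Qed.

Definition edgeless : sgraph := SGraph edgeless_sym edgeless_irrefl.

Definition path_rel : rel 'I_n :=
  fun i j => (i.+1 == j :> nat) || (j.+1 == i :> nat).

Lemma path_sym : symmetric path_rel.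
Proof. by move=> i j; rewrite /path_rel orbC. Qed.

Lemma path_irrefl : irreflexive path_rel.
Proof. by move=> i; rewrite /path_rel orbb gtn_eqF. Qed.

Definition path_graph : sgraph := SGraph path_sym path_irrefl.

End EdgelessPath.

Section Join.
Variables G1 G2 : sgraph.

Definition join_rel : rel (G1 + G2)%type := fun x y =>
  match x, y with
  | inl u, inl v => adj u v
  | inr u, inr v => adj u v
  | _, _ => true
  end.

Lemma join_sym : symmetric join_rel.
Proof. by move=> [u|u] [v|v] //=; apply: adj_sym. Qed.

Lemma join_irrefl : irreflexive join_rel.
Proof. by move=> [u|u] /=; apply: adj_irrefl. Qed.

Definition graph_join : sgraph := SGraph join_sym join_irrefl.

End Join.

Definition fan_graph (m n : nat) : sgraph :=
  graph_join (edgeless m) (path_graph n).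

Section Matrices.
Variables (R : pzRingType) (G : sgraph).

Definition degree (v : G) : nat := #|[set w | adj v w]|.

(* Row and column i stand for the vertex enum_val i. *)
Definition adjacency_mx : 'M[R]_#|G| :=
  \matrix_(i, j) (adj (enum_val i) (enum_val j))%:R.

Definition degree_mx : 'M[R]_#|G| :=
  diag_mx (\row_i (degree (enum_val i))%:R).

Definition laplacian_mx : 'M[R]_#|G| := degree_mx - adjacency_mx.

End Matrices.

(* The eigenvalues of A, with algebraic multiplicity, are the entries of s, in
   some order; since the characteristic polynomial is monic of degree k, this
   forces size s = k. *)
Definition has_spectrum (R : comNzRingType) (k : nat) (A : 'M[R]_k)
    (s : seq R) : Prop :=
  char_poly A = \prod_(a <- s) ('X - a%:P).

(* Main.v *)
Require Import Defs.
From mathcomp Require Import all_boot all_order all_algebra.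
From mathcomp Require Import all_classical all_reals all_analysis.
From mathcomp Require Import perm ring lra.

(** The characteristic polynomial of the Laplacian of a join is determined by
those of the two parts; the spectrum of the fan then follows from the trivial
spectrum of the edgeless graph and the classical spectrum of the path.

Join ([char_poly_join]).  Write p and q for the numbers of vertices of G1 and
G2.  In block form, xI - L(G1 + G2) has diagonal blocks (x - q)I - L(G1) and
(x - p)I - L(G2), and off-diagonal blocks J with all entries 1.  Since the rows
of a Laplacian sum to 0, the diagonal blocks have constant row sums y = x - q
and z = x - p, so they multiply J by y and by z.  Over fractions this gives
  [A, J; J, B] = diag(A, B) [I, J / y; J / z, I],
whose last factor is a low-rank perturbation of the identity, of determinant
1 - p q / (y z); and y z - p q = x (x - (p + q)).  [det_block_const] carries this
out without denominators, in an integral domain.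

Path ([has_spectrum_path]).  For 0 <= j < n put h = pi j / (2 n).  The vector
k |-> cos ((2 k + 1) h) satisfies the interior recurrence with eigenvalue
2 - 2 cos (2 h), and it is invariant under the reflections k <-> -1 - k and
k <-> 2 n - 1 - k, so the missing neighbours of the two end vertices contribute
nothing.  These n eigenvalues are distinct because cos is injective on [0, pi],
so they are all the roots of the characteristic polynomial.

Conclusion.  With p = m and q = n, the identity for the join reads
  (x - n) (x - m) P(x) = x (x - m - n) (x - n)^m prod_(j < n) (x - m - c_j),
where c_j = 2 - 2 cos (pi j / n).  As c_0 = 0, cancelling (x - n) (x - m) leaves
the announced factorization. *)

Set Implicit Arguments.
Unset Strict Implicit.
Unset Printing Implicit Defensive.

Import Order.TTheory GRing.Theory Num.Theory.
Local Open Scope ring_scope.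

(** * Determinants perturbed by constant blocks *)

Lemma mul_const_mx (R : pzSemiRingType) (k l p : nat) (a b : R) :
  (const_mx a : 'M[R]_(k, l)) *m (const_mx b : 'M[R]_(l, p)) =
  const_mx (a * b *+ l).
Proof.
apply/matrixP=> i j; rewrite !mxE.
under eq_bigr do rewrite !mxE.
by rewrite sumr_const card_ord.
Qed.

Lemma mulmx_row_sum (R : pzSemiRingType) (k l : nat) (A : 'M[R]_k) (y : R) :
  (forall i, \sum_j A i j = y) ->
  A *m (const_mx 1 : 'M[R]_(k, l)) = const_mx y.
Proof.
move=> Ay; apply/matrixP=> i j; rewrite !mxE -(Ay i).
by apply: eq_bigr => u _; rewrite mxE mulr1.
Qed.

(** Homogeneous Weinstein-Aronszajn identity: both sides compute the determinant
of [t I, - U; V, I], made block triangular by clearing [V] or by clearing [- U].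
Keeping the powers of [t] makes it valid over any commutative ring. *)
Lemma det_scalar_addC (R : comPzRingType) (k p : nat) (t : R)
    (U : 'M[R]_(k, p)) (V : 'M[R]_(p, k)) :
  t ^+ p * \det (t%:M + U *m V) = t ^+ k * \det (t%:M + V *m U).
Proof.
pose M := block_mx t%:M (- U) V 1%:M.
have detM : \det M = \det (t%:M + U *m V).
  have : M *m block_mx 1%:M 0 (- V) 1%:M
      = block_mx (t%:M + U *m V) (- U) 0 1%:M.
    rewrite mulmx_block !mulmx0 !mulmx1 !mul1mx mulmxN mulNmx opprK.
    by rewrite subrr !add0r.
  move/(congr1 determinant).
  by rewrite det_mulmx det_lblock det_ublock !det1 !mulr1.
have : M *m block_mx 1%:M U 0 t%:M = block_mx t%:M 0 V (t%:M + V *m U).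
  rewrite mulmx_block !mulmx0 !mulmx1 mul1mx !addr0 mul_scalar_mx mul_mx_scalar.
  by rewrite scalerN subrr addrC.
move/(congr1 determinant).
rewrite det_mulmx det_ublock det_lblock detM det1 mul1r !det_scalar.
by rewrite mulrC.
Qed.

(** A constant matrix has rank at most one, so the previous identity reduces its
determinant to a 1 x 1 one; the extra factor [t] covers the case [k = 0]. *)
Lemma det_scalar_add_const (R : comPzRingType) (k : nat) (t b : R) :
  t * \det (t%:M + const_mx b : 'M[R]_k) = t ^+ k * (t + b *+ k).
Proof.
have /= := det_scalar_addC t (const_mx b : 'M[R]_(k, 1))
  (const_mx 1 : 'M[R]_(1, k)).
rewrite !mul_const_mx mulr1 mul1r mulr1n expr1 => ->.
by rewrite det_mx11 !mxE eqxx mulr1n.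
Qed.

(** Multiplying by [y I, - J; 0, y I] clears the upper right block because
[A J = y J], leaving [y B - p J] as Schur complement.  As [B J = z J], this
complement is, up to the factor [z], the product of [B] and the matrix
[y z I - p J].  The powers of [y] and [z] introduced on the way are
cancelled at the end. *)
Lemma det_block_const (R : idomainType) (p q : nat)
    (A : 'M[R]_p) (B : 'M[R]_q) (y z : R) : y != 0 -> z != 0 ->
  (forall i, \sum_j A i j = y) -> (forall i, \sum_j B i j = z) ->
  y * z * \det (block_mx A (const_mx 1) (const_mx 1) B)
    = (y * z - (p * q)%:R) * \det A * \det B.
Proof.
move=> y0 z0 Ay Bz.
set M := block_mx _ _ _ _; pose C := y *: B - const_mx p%:R.
have eliminate : y ^+ q * \det M = \det A * \det C.
  have : M *m block_mx y%:M (- const_mx 1) 0 y%:M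
      = block_mx (y *: A) 0 (y *: const_mx 1) C.
    rewrite mulmx_block !mulmx0 !addr0 !mul_mx_scalar !mulmxN.
    rewrite (mulmx_row_sum _ Ay) mul_const_mx mulr1 [_ + y *: B]addrC.
    congr block_mx; apply/matrixP=> i j; rewrite !mxE.
    by rewrite mulr1 addNr.
  move/(congr1 determinant).
  rewrite det_mulmx det_ublock det_lblock !det_scalar detZ => E.
  by apply: (mulfI (expf_neq0 p y0)); rewrite [RHS]mulrA -E; ring.
have factor : z ^+ q * \det C * (y * z)
    = \det B * ((y * z) ^+ q * (y * z - (p * q)%:R)).
  have : B *m ((y * z)%:M + const_mx (- p%:R)) = z *: C.
    have -> : const_mx (- p%:R) = - p%:R *: const_mx 1 :> 'M[R]_q.
      by apply/matrixP=> i j; rewrite !mxE mulr1.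
    rewrite mulmxDr mul_mx_scalar -scalemxAr (mulmx_row_sum _ Bz).
    by apply/matrixP=> i j; rewrite !mxE; ring.
  move/(congr1 determinant); rewrite det_mulmx detZ => <-.
  rewrite -mulrA [X in _ * X]mulrC det_scalar_add_const.
  by rewrite mulNrn -mulrnA.
apply: (mulfI (expf_neq0 q (mulf_neq0 y0 z0))).
rewrite [in LHS]exprMn.
transitivity (y * z * z ^+ q * (y ^+ q * \det M)); first by ring.
rewrite eliminate.
transitivity (\det A * (z ^+ q * \det C * (y * z))); first by ring.
by rewrite factor; ring.
Qed.

(** * Characteristic polynomials *)

(** Needed to move between the enumeration of a sum type and the concatenation
of the enumerations of its summands: [f] is allowed to relate ordinals of
sizes that are only provably equal. *)
Lemma char_poly_mxsub_bij (R : comNzRingType) (k l : nat) (f : 'I_k -> 'I_l)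
    (A : 'M[R]_l) : bijective f -> char_poly (mxsub f f A) = char_poly A.
Proof.
move=> bij_f; have ekl : k = l.
  by rewrite -[k]card_ord -[l]card_ord (bij_eq_card bij_f).
case: l / ekl in f A bij_f *.
pose s := perm (bij_inj bij_f).
have -> : mxsub f f A = row_perm s (col_perm s A).
  by apply/matrixP=> i j; rewrite !mxE !permE.
rewrite /char_poly.
have -> : char_poly_mx (row_perm s (col_perm s A))
    = row_perm s (col_perm s (char_poly_mx A)).
  by apply/matrixP=> i j; rewrite !mxE (inj_eq perm_inj).
rewrite row_permE col_permE !det_mulmx !det_perm mulrC -mulrA.
by rewrite odd_permV -signr_addb addbb mulr1.
Qed.

Lemma comp_char_poly (R : comNzRingType) (k : nat) (A : 'M[R]_k) (q : {poly R}) :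
  char_poly A \Po q = \det (q%:M - map_mx polyC A).
Proof.
rewrite /char_poly -[LHS]/((comp_poly q : {rmorphism _ -> _}) _) -det_map_mx.
congr determinant; apply/matrixP=> i j; rewrite !mxE rmorphB /= comp_polyC.
by rewrite rmorphMn /= comp_polyX.
Qed.

(** * Laplacians of joins *)

Lemma laplacianE (R : pzRingType) (G : sgraph) (i j : 'I_#|G|) :
  laplacian_mx R G i j =
  (degree (enum_val i))%:R *+ (i == j) - (adj (enum_val i) (enum_val j))%:R.
Proof. by rewrite !mxE. Qed.

Lemma degreeE (R : pzRingType) (G : sgraph) (v : G) :
  (degree v)%:R = \sum_w (adj v w)%:R :> R.
Proof.
rewrite /degree -sum1_card natr_sum (big_mkcond (fun w => w \in _)) /=.
by apply: eq_bigr => w _; rewrite inE; case: ifP.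
Qed.

(** The Laplacian as a difference operator; being symmetric, it acts in the same
way on row vectors, the convention for eigenvectors followed here. *)
Lemma mul_row_laplacian (R : comPzRingType) (G : sgraph) (f : G -> R)
    (j : 'I_#|G|) :
  ((\row_i f (enum_val i)) *m laplacian_mx R G) 0 j =
  \sum_w (f (enum_val j) - f w) *+ adj (enum_val j) w.
Proof.
rewrite mxE.
under eq_bigr do rewrite laplacianE mxE mulrBr.
rewrite sumrB (bigD1 j) //= eqxx mulr1n big1 ?addr0; last first.
  by move=> i /negbTE->; rewrite mulr0n mulr0.
rewrite degreeE mulr_sumr.
rewrite -(big_enum_val (fun w => f w * (adj w (enum_val j))%:R)) /=.
rewrite -sumrB; apply: eq_bigr => w _.
by rewrite adj_sym mulrnBl !mulr_natr.
Qed.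

Lemma laplacian_row_sum (R : comPzRingType) (G : sgraph) (i : 'I_#|G|) :
  \sum_j laplacian_mx R G i j = 0.
Proof.
under eq_bigr do rewrite laplacianE.
rewrite sumrB (bigD1 i) //= eqxx mulr1n big1 ?addr0; last first.
  by move=> j; rewrite eq_sym => /negbTE->.
by rewrite degreeE -(big_enum_val (fun w => (adj _ w)%:R)) subrr.
Qed.

(** The enumeration of the join need not list [G1] before [G2], hence the
reindexing [f]. *)
Lemma laplacian_join (R : pzRingType) (G1 G2 : sgraph) :
  exists2 f : 'I_(#|G1| + #|G2|) -> 'I_#|graph_join G1 G2|, bijective f &
  mxsub f f (laplacian_mx R (graph_join G1 G2)) =
  block_mx (laplacian_mx R G1 + (#|G2|%:R)%:M) (const_mx (-1)) (const_mx (-1))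
           (laplacian_mx R G2 + (#|G1|%:R)%:M).
Proof.
pose e (s : 'I_#|G1| + 'I_#|G2|) : graph_join G1 G2 :=
  match s with inl a => inl (enum_val a) | inr b => inr (enum_val b) end.
pose d (v : graph_join G1 G2) : 'I_#|G1| + 'I_#|G2| :=
  match v with inl u => inl (enum_rank u) | inr w => inr (enum_rank w) end.
have eK : cancel e d by case=> a /=; rewrite enum_valK.
have dK : cancel d e by case=> a /=; rewrite enum_rankK.
exists (fun i => enum_rank (e (fintype.split i))).
  exists (fun v => unsplit (d (enum_val v))) => i.
    by rewrite enum_rankK eK splitK.
  by rewrite unsplitK dK enum_valK.
have deg1 (u : G1) : (@degree (graph_join G1 G2) (inl u))%:R
    = (degree u)%:R + #|G2|%:R :> R.
  by rewrite !degreeE big_sumType /= sumr_const.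
have deg2 (u : G2) : (@degree (graph_join G1 G2) (inr u))%:R
    = (degree u)%:R + #|G1|%:R :> R.
  by rewrite !degreeE big_sumType /= sumr_const addrC.
have e_eq (x y : 'I_#|G1| + 'I_#|G2|) :
    (enum_rank (e x) == enum_rank (e y)) = (x == y).
  by rewrite (inj_eq enum_rank_inj) (can_eq eK).
rewrite -[LHS]submxK; congr block_mx; apply/matrixP=> i j;
  rewrite !mxE !enum_rankK e_eq;
  rewrite ?(unsplitK (inl _)) ?(unsplitK (inr _)) /=.
- by rewrite deg1 mulrnDl addrAC.
- by rewrite sub0r.
- by rewrite sub0r.
- by rewrite deg2 mulrnDl addrAC.
Qed.

Lemma oppr_const_mx (R : zmodType) (k l : nat) (a : R) :
  - (const_mx a : 'M[R]_(k, l)) = const_mx (- a).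
Proof. by apply/matrixP=> i j; rewrite !mxE. Qed.

Lemma char_poly_mx_add_scalar (R : nzRingType) (k : nat) (A : 'M[R]_k) (c : R) :
  char_poly_mx (A + c%:M) = ('X - c%:P)%:M - map_mx polyC A.
Proof.
apply/matrixP=> i j; rewrite !mxE rmorphD rmorphMn /= mulrnBl opprD.
by rewrite addrAC addrA.
Qed.

Lemma char_poly_mx_block (R : nzRingType) (p q : nat) (A : 'M[R]_p)
    (B : 'M[R]_(p, q)) (C : 'M[R]_(q, p)) (D : 'M[R]_q) :
  char_poly_mx (block_mx A B C D) =
  block_mx (char_poly_mx A) (map_mx polyC (- B)) (map_mx polyC (- C))
           (char_poly_mx D).
Proof.
rewrite /char_poly_mx scalar_mx_block map_block_mx opp_block_mx add_block_mx.
by rewrite !sub0r !map_mxN.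
Qed.

(** The left factors cancel those that the eigenvalue 0 of each Laplacian
contributes on the right; keeping them makes the identity hold for graphs
without vertices as well. *)
Lemma char_poly_join (R : idomainType) (G1 G2 : sgraph) :
  ('X - #|G2|%:R%:P) * ('X - #|G1|%:R%:P)
    * char_poly (laplacian_mx R (graph_join G1 G2)) =
  'X * ('X - (#|G1| + #|G2|)%:R%:P)
    * (char_poly (laplacian_mx R G1) \Po ('X - #|G2|%:R%:P))
    * (char_poly (laplacian_mx R G2) \Po ('X - #|G1|%:R%:P)).
Proof.
have [f bij_f Lf] := laplacian_join R G1 G2.
rewrite -(char_poly_mxsub_bij _ bij_f) Lf !comp_char_poly /char_poly.
have row_sum (G : sgraph) (q : {poly R}) i :
    \sum_j (q%:M - map_mx polyC (laplacian_mx R G)) i j = q.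
  under eq_bigr do rewrite !mxE -laplacianE.
  rewrite sumrB -rmorph_sum laplacian_row_sum rmorph0 subr0 (bigD1 i) //=.
  rewrite eqxx mulr1n big1 ?addr0 // => j; rewrite eq_sym.
  by move=> /negbTE->.
rewrite char_poly_mx_block !char_poly_mx_add_scalar.
rewrite !oppr_const_mx opprK !map_const_mx rmorph1.
rewrite (det_block_const _ _ (row_sum G1 _) (row_sum G2 _)) ?polyXsubC_eq0 //.
congr (_ * _ * _); rewrite !polyC_natr natrM natrD; ring.
Qed.

(** * The path *)

Section PathSpectrum.
Variable R : realType.

Lemma sum_path_neighbours (n : nat) (F : nat -> R) (w : 'I_n) :
  \sum_(u < n) F u *+ path_rel w u =
  F w.+1 *+ (w.+1 < n)%N + F w.-1 *+ (0 < w)%N.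
Proof.
have sum_at k : \sum_(u < n) F u *+ (k == u :> nat) = F k *+ (k < n)%N.
  rewrite mulrb -(big_ord1_eq +%R F k n) [RHS]big_mkcond /=.
  by apply: eq_bigr => u _; rewrite mulrb eq_sym.
rewrite -sum_at.
have -> : F w.-1 *+ (0 < w)%N = \sum_(u < n) F u *+ (u.+1 == w :> nat).
  case: (nat_of_ord w) (ltn_ord w) => [|k] kn.
    by rewrite big1 // => u _; rewrite mulr0n.
  have := sum_at k; rewrite (ltnW kn) => <-.
  by apply: eq_bigr => u _; rewrite eqSS eq_sym.
rewrite -big_split; apply: eq_bigr => u _ /=; rewrite -mulrnDr /path_rel.
by congr (_ *+ _); case: eqP => // <-; rewrite gtn_eqF // ltnW.
Qed.

Lemma sin_nat_pi (j : nat) : sin (pi * j%:R) = 0 :> R.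
Proof.
elim: j => [|j IHj]; first by rewrite mulr0 sin0.
by rewrite -natr1 mulrDr mulr1 sinD IHj sinpi mul0r mulr0 addr0.
Qed.

(** In the interior this is
[2 cos a - cos (a + 2 h) - cos (a - 2 h) = (2 - 2 cos (2 h)) cos a].  It persists
at the ends because the value that an additional neighbour would carry there
equals the value at the end vertex itself. *)
Lemma path_eigenvector (n j : nat) (w : 'I_n) (h : R) :
  h = pi * j%:R / n%:R / 2 ->
  \sum_(u < n) (cos (h * w.*2.+1%:R) - cos (h * u.*2.+1%:R)) *+ path_rel w u
    = (2 - 2 * cos (pi * j%:R / n%:R)) * cos (h * w.*2.+1%:R).
Proof.
move=> hE; pose F k := cos (h * w.*2.+1%:R) - cos (h * k.*2.+1%:R).
have n0 : n%:R != 0 :> R by rewrite pnatr_eq0 -lt0n (leq_ltn_trans _ (ltn_ord w)).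
have stepE : pi * j%:R / n%:R = h + h by rewrite hE; field.
rewrite (sum_path_neighbours F) stepE.
set a := h * w.*2.+1%:R.
(* At the right end, a and a + 2 h are symmetric about pi j, and so is cos. *)
have -> : F w.+1 *+ (w.+1 < n)%N = cos a - cos (a + (h + h)).
  have -> : a + (h + h) = h * w.+1.*2.+1%:R.
    by rewrite /a doubleS -!natr1; ring.
  case: ltnP => // nw; rewrite mulr0n.
  have wn : w.+1 = n by apply/eqP; rewrite eqn_leq nw ltn_ord.
  have -> : h * w.+1.*2.+1%:R = pi * j%:R + h.
    by rewrite wn -natr1 -muln2 natrM hE; field.
  have -> : a = pi * j%:R - h.
    have -> : pi * j%:R = h * w.+1.*2%:R by rewrite wn -muln2 natrM hE; field.
    by rewrite /a doubleS -!natr1; ring.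
  by rewrite cosB cosD sin_nat_pi; ring.
(* At the left end, a = h and a - 2 h = - h. *)
have -> : F w.-1 *+ (0 < w)%N = cos a - cos (a - (h + h)).
  rewrite /F /a; case: (nat_of_ord w) => [|k] /=.
    by rewrite mulr0n mulr1 opprD addrA subrr sub0r cosN subrr.
  have -> // : h * k.+1.*2.+1%:R - (h + h) = h * k.*2.+1%:R.
  by rewrite doubleS -!natr1; ring.
by rewrite cosB (cosD a); ring.
Qed.

(** The characteristic polynomial has degree [n], so the [n] distinct
eigenvalues found above exhaust its roots, each with multiplicity one. *)
Lemma has_spectrum_path (n : nat) :
  has_spectrum (laplacian_mx R (path_graph n))
    [seq 2 - 2 * cos (pi * j%:R / n%:R) | j <- iota 0 n].
Proof.
rewrite /has_spectrum; set s := map _ _.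
rewrite [LHS](@all_roots_prod_XsubC _ _ s).
- by rewrite (monicP (char_poly_monic _)) scale1r.
- by rewrite size_char_poly size_map size_iota card_ord.
- apply/allP=> _ /mapP[j + ->]; rewrite mem_iota add0n => /andP[_ jn].
  have n0 : 0 < n%:R :> R by rewrite ltr0n (leq_ltn_trans _ jn).
  pose h : R := pi * j%:R / n%:R / 2.
  rewrite -eigenvalue_root_char; apply/eigenvalueP.
  pose f (u : path_graph n) := cos (h * u.*2.+1%:R).
  exists (\row_i f (enum_val i)).
    apply/rowP=> i; rewrite mul_row_laplacian.
    by rewrite !mxE; apply: path_eigenvector.
  (* The eigenvector is nonzero at the first vertex, since 0 <= h < pi / 2. *)
  apply/eqP=> /rowP/(_ (enum_rank (Ordinal (leq_ltn_trans (leq0n j) jn)))).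
  rewrite !mxE enum_rankK /f /= mulr1 => /eqP; apply/negP.
  rewrite gt_eqF // cos_gt0_pihalf //.
  have pi0 := pi_gt0 R.
  have h0 : 0 <= h by rewrite !divr_ge0 ?mulr_ge0 ?ler0n // ltW.
  apply/andP; split; first by apply: lt_le_trans h0; lra.
  by rewrite /h ltr_pM2r ?invr_gt0 // ltr_pdivrMr // ltr_pM2l // ltr_nat.
- rewrite uniq_rootsE map_inj_in_uniq ?iota_uniq // => j k.
  rewrite !mem_iota !add0n /= => jn kn E.
  have n0 : 0 < n%:R :> R by rewrite ltr0n (leq_ltn_trans _ jn).
  have pi0 := pi_gt0 R.
  have angle i : (i < n)%N -> pi * i%:R / n%:R \in `[0, (pi : R)].
    move=> lt_in; rewrite in_itv /= divr_ge0 ?mulr_ge0 ?ler0n ?(ltW pi0) //=.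
    by rewrite ler_pdivrMr // ler_pM2l // ler_nat ltnW.
  have : cos (pi * j%:R / n%:R) = cos (pi * k%:R / n%:R) :> R by lra.
  move/(cos_inj (angle j jn) (angle k kn)) => {}E.
  apply/eqP; rewrite -(eqr_nat R); apply/eqP.
  by apply: (mulfI (lt0r_neq0 pi0)); apply: (divIf (lt0r_neq0 n0)).
Qed.

End PathSpectrum.

(** * The fan *)

Lemma char_poly_edgeless (R : comNzRingType) (m : nat) :
  char_poly (laplacian_mx R (edgeless m)) = 'X^m.
Proof.
have -> : laplacian_mx R (edgeless m) = 0.
  apply/matrixP=> i j; rewrite laplacianE degreeE big1 //.
  by rewrite mxE mul0rn subr0.
by rewrite /char_poly /char_poly_mx map_mx0 subr0 det_scalar card_ord.
Qed.

Lemma comp_prod_XsubC (R : comNzRingType) (s : seq R) (c : R) :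
  (\prod_(a <- s) ('X - a%:P)) \Po ('X - c%:P)
    = \prod_(a <- s) ('X - (c + a)%:P).
Proof.
rewrite rmorph_prod; apply: eq_bigr => a _.
by rewrite /= comp_polyB comp_polyX comp_polyC polyCD opprD addrA.
Qed.

Theorem theorem3p3 (R : realType) (m n : nat)
    (hm : (2 <= m)%N) (hn : (2 <= n)%N) :
  has_spectrum (laplacian_mx R (fan_graph m n))
    ([:: 0; (m + n)%:R]
     ++ nseq (m - 1) n%:R
     ++ [seq m%:R + 2 - 2 * cos (pi * j%:R / n%:R) | j <- iota 1 (n - 1)]).
Proof.
have := char_poly_join R (edgeless m) (path_graph n).
rewrite has_spectrum_path char_poly_edgeless comp_prod_XsubC comp_Xn_poly.
rewrite !card_ord /has_spectrum -/(fan_graph m n) => E.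
case: m n hm hn E => [|m] [|n] // _ _ E.
rewrite !subSS !subn0.
apply: (@mulfI _ (('X - n.+1%:R%:P) * ('X - m.+1%:R%:P))).
  by rewrite mulf_neq0 ?polyXsubC_eq0.
rewrite {}E !big_cat /= !big_cons big_nil mulr1 subr0.
rewrite big_nseq iter_mulr_1.
rewrite !big_map mulr0 mul0r cos0 mulr1 subrr addr0 exprS.
under eq_bigr do rewrite addrA.
ring.
Qed.
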